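(* Let $r\ge4$ be real and $p,f$ integers with $0\le f<p$. Consider all $p$-processor contract schedules $X$ such that, for every processor $j$, the single-processor schedule run on processor $j$ has acceleration ratio at most $r$. Among these there is a schedule minimizing the fault-tolerant acceleration ratio $\mathrm{acc}_f$, and its value is \[ \min\Big\{\frac{b^{p+f+1}}{b^p-1}\ :\ b\in\big[\zeta_{1,r}^{1/p},\ \zeta_{2,r}^{1/p}\big]\Big\}. \]
   Context: A single-processor contract schedule is a strictly increasing sequence $(x_i)_{i\ge0}$ of positive reals run back to back from time $0$; its acceleration ratio is $\sup_{T\ge x_0}T/\ell(T)$, where $\ell(T)$ is the largest length of a contract completed by time $T$. A $p$-processor schedule $X$ assigns such a sequence $(x_{i,j})_{i\ge0}$ to each processor $j\in\{0,\dots,p-1\}$, all starting at time $0$. For time $t$ let $l_X(t,j)$ be the largest contract length completed on processor $j$ by time $t$ (0 if none) and $\ell_{X,f}(t)$ the $(f+1)$-th largest value among $\{l_X(t,j)\}_j$ (the longest completed contract when up to $f$ processors are faulty, a faulty processor completing nothing). The fault-tolerant acceleration ratio is $\mathrm{acc}_f(X)=\sup_{t\ge\max_j x_{0,j}}t/\ell_{X,f}(t)$. The requirement on each processor corresponds to acceleration ratio at most $r$ when all but one processor are faulty. For $r\ge4$, $\zeta_{1,r}=\frac{r-\sqrt{r^2-4r}}{2}$ and $\zeta_{2,r}=\frac{r+\sqrt{r^2-4r}}{2}$. *)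

(* Defs.v *)
From HB Require Import structures.
From mathcomp Require Import all_boot all_order all_algebra.
From mathcomp Require Import all_classical all_reals all_analysis.
Set Implicit Arguments.
Unset Strict Implicit.
Unset Printing Implicit Defensive.
Import Order.TTheory GRing.Theory Num.Theory.
Local Open Scope classical_set_scope.
Local Open Scope ring_scope.

Section ContractSchedules.
Context {R : realType}.

Definition contract_schedule (x : nat -> R) : Prop :=
  (forall i, 0 < x i) /\ increasing_seq x.

(* Contracts run back to back from time 0. *)
Definition completion (x : nat -> R) (i : nat) : R := \sum_(k < i.+1) x k.

(* [sup] is 0 on the empty set, so this is 0 when nothing has been completed;
   otherwise, for a contract schedule, the set is finite (completion times are
   unbounded) and the supremum is a maximum. *)
Definition longest_completed (x : nat -> R) (t : R) : R :=
  sup [set x i | i in [set i | completion x i <= t]].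

Definition acceleration_ratio (x : nat -> R) : \bar R :=
  ereal_sup [set (t / longest_completed x t)%:E | t in [set t | x 0%N <= t]].

Section MultiProcessor.
Variable p : nat.
Implicit Type X : 'I_p -> nat -> R.

(* The [f.+1]-th largest value, counted with multiplicity: entry [f] of the
   list sorted in nonincreasing order. *)
Definition longest_completed_faulty (f : nat) X (t : R) : R :=
  (sort >=%R [seq longest_completed (X j) t | j <- enum 'I_p])`_f.

(* The lengths are positive, so 0 is a neutral default for the maximum. *)
Definition fault_tolerant_acc (f : nat) X : \bar R :=
  ereal_sup [set (t / longest_completed_faulty f X t)%:E |
             t in [set t | \big[Num.max/0]_(j < p) X j 0%N <= t]].

Definition admissible (r : R) X : Prop :=
  forall j, contract_schedule (X j) /\ (acceleration_ratio (X j) <= r%:E)%E.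

End MultiProcessor.

Definition zeta1 (r : R) : R := (r - Num.sqrt (r ^+ 2 - 4 * r)) / 2.
Definition zeta2 (r : R) : R := (r + Num.sqrt (r ^+ 2 - 4 * r)) / 2.

End ContractSchedules.

Definition is_minimum d (T : porderType d) (A : set T) (m : T) : Prop :=
  A m /\ lbound A m.

(* Main.v *)
(** Upper bound: contract number [n], of length [b ^+ n], is run on processor
    [n %% p].  The condition that [b ^+ p] lies between the two zetas, the roots
    of [q ^+ 2 - r * q + r], is exactly admissibility.

    Lower bound: let [S_i] be the completion times on one processor and
    [q_i = S_i / S_(i-1)].  Admissibility gives [q_(i+1) <= r * (1 - 1 / q_i)],
    whence [q_i <= Q] eventually, for every [Q > zeta2 r].  If the ratio [A] of
    the schedule were below the minimum, then with [c = (f + 1) / p] and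
    [b ^+ p = q_i] the inequality [A < b ^+ (p + f + 1) / (b ^+ p - 1)], uniform
    over [1 < b ^+ p <= Q], says that the contract completed at [S_i] serves only
    times [t] with [ln t <= ln S_i + a * (ln S_i - ln S_(i-1)) - eta], for some
    [a < c] and [eta > 0].  On a logarithmic time scale a processor is thus useful
    with density at most [a], so the [p] processors together cover less than
    [c * p = f + 1] times, although [f + 1] of them must be useful at any time. *)
Require Import Defs.
From HB Require Import structures.
From mathcomp Require Import all_boot all_order all_algebra.
From mathcomp Require Import all_classical all_reals all_analysis.
From mathcomp Require Import ring lra zify.
Import Order.TTheory GRing.Theory Num.Theory.
Import numFieldNormedType.Exports.
Local Open Scope classical_set_scope.
Local Open Scope ring_scope.
Set Implicit Arguments.
Unset Strict Implicit.
Unset Printing Implicit Defensive.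

(** * Order statistics and completion times *)

(** In the nonincreasing sort the entries at least [w] form a prefix, so entry [f] is one of them
    iff that prefix has more than [f] entries. This turns fault tolerance into counting
    processors. *)
Lemma le_nth_sort (R : realType) (s : seq R) (f : nat) (w : R) :
  (f < size s)%N -> (w <= (sort >=%R s)`_f) = (f < count (>= w)%R s)%N.
Proof.
move=> fs; rewrite -(count_sort >=%R); set s' := sort _ s.
have fs' : (f < size s')%N by rewrite size_sort.
have hs : sorted >=%R s' by apply: sort_sorted => x y; exact: le_total.
have tr : transitive (>=%R : rel R) by move=> x y z yx zx; exact: le_trans zx yx.
have nth_le := sorted_leq_nth tr (@lexx _ R) 0 hs.
apply/idP/idP => [wf|]; last (apply: contraLR; rewrite -ltNge -leqNgt => fw).
  rewrite -(cat_take_drop f.+1 s') count_cat (leq_trans _ (leq_addr _ _))//.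
  have sz : size (take f.+1 s') = f.+1 by rewrite size_take; case: ltnP => //; lia.
  rewrite -[X in (X <= _)%N]sz (_ : count _ _ = size (take f.+1 s'))//.
  apply/eqP; rewrite -all_count; apply/(all_nthP 0) => i; rewrite sz => ilt.
  rewrite nth_take//= (le_trans wf)//; apply: (nth_le i f); rewrite ?inE; lia.
rewrite -(cat_take_drop f s') count_cat (_ : count _ (drop f s') = 0)%N.
  by rewrite addn0 (leq_trans (count_size _ _))// size_takel// ltnW.
apply/eqP; rewrite -leqn0 leqNgt -has_count -all_predC.
apply/(all_nthP 0) => i; rewrite size_drop => ilt /=.
by rewrite nth_drop -ltNge (le_lt_trans _ fw)//; apply: (nth_le f); rewrite ?inE -?ltn_subRL ?leq_addr.
Qed.

Lemma longest_completed_faulty_ge (R : realType) (p f : nat)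
    (X : 'I_p -> nat -> R) (t w : R) : (f < p)%N ->
  (w <= longest_completed_faulty f X t) =
  (f < #|[set j | (w <= longest_completed (X j) t)%R]%SET|)%N.
Proof.
move=> fp; rewrite /longest_completed_faulty le_nth_sort; last first.
  by rewrite size_map size_enum_ord.
by rewrite count_map cardsE cardE -size_filter enumT.
Qed.

Lemma completionS (R : realType) (x : nat -> R) i :
  completion x i.+1 = completion x i + x i.+1.
Proof. by rewrite /completion big_ord_recr. Qed.

Lemma completion0 (R : realType) (x : nat -> R) : completion x 0 = x 0%N.
Proof. by rewrite /completion big_ord1. Qed.

Lemma completion_gt0 (R : realType) (x : nat -> R) i :
  (forall i, 0 < x i) -> 0 < completion x i.
Proof.
move=> x0; elim: i => [|i ih]; first by rewrite completion0.
by rewrite completionS addr_gt0.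
Qed.

Lemma ltr_completion (R : realType) (x : nat -> R) :
  (forall i, 0 < x i) -> {mono completion x : i j / (i < j)%N >-> i < j}.
Proof.
move=> x0; have h : {homo completion x : i j / (i < j)%N >-> i < j}.
  by apply: homo_ltn => [? ? ?|k]; [exact: lt_trans|rewrite completionS ltrDl].
move=> i j; case: (ltngtP i j) => [/h//|/h|->]; last exact: ltxx.
by move=> /ltW; rewrite leNgt => /negbTE.
Qed.

Lemma ler_completion (R : realType) (x : nat -> R) :
  (forall i, 0 < x i) -> {mono completion x : i j / (i <= j)%N >-> i <= j}.
Proof. by move=> x0 i j; rewrite leNgt ltr_completion// -leqNgt. Qed.

Lemma completion_bracket (R : realType) (x : nat -> R) (t : R) :
  contract_schedule x -> x 0%N <= t ->
  exists i, completion x i <= t < completion x i.+1.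
Proof.
move=> [x0 xi] xt.
(* Lengths never fall below the first one, so completion times grow at least linearly and are
   unbounded. *)
have lb i : x 0%N * i.+1%:R <= completion x i.
  elim: i => [|i ih]; first by rewrite mulr1 completion0.
  by rewrite completionS -natr1 mulrDr mulr1 lerD// xi.
have ex : exists i, t < completion x i.
  exists (Num.bound (t / x 0%N)); apply: lt_le_trans (lb _).
  rewrite -ltr_pdivrMl// mulrC (lt_le_trans (archi_boundP _))//.
    by rewrite divr_ge0 ?(ltW (x0 _))// (le_trans _ xt)// ltW.
  by rewrite ler_nat.
case: (ex_minnP ex) => -[|i] ti imin; first by rewrite completion0 ltNge xt in ti.
by exists i; rewrite ti andbT leNgt; apply/negP => /imin; rewrite ltnn.
Qed.

Lemma longest_completed_eq (R : realType) (x : nat -> R) (t : R) i :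
  contract_schedule x -> completion x i <= t < completion x i.+1 ->
  longest_completed x t = x i.
Proof.
move=> [x0 xi] /andP[it ti]; apply/eqP; rewrite eq_le /longest_completed.
have ub : ubound [set x i | i in [set i | completion x i <= t]] (x i).
  move=> _ [k /= kt <-]; rewrite xi -ltnS -(ltr_completion x0).
  exact: le_lt_trans kt ti.
apply/andP; split; first by apply: ge_sup => //; exists (x i), i.
by apply: ub_le_sup; [exists (x i)|exists i].
Qed.

Lemma le_longest_completed (R : realType) (x : nat -> R) (t : R) i :
  contract_schedule x -> completion x i <= t -> x i <= longest_completed x t.
Proof.
move=> xs it; have [x0 xi] := xs.
have xt : x 0%N <= t.
  rewrite (le_trans _ it)// -completion0.
  by rewrite ler_completion.
have [k /andP[kt tk]] := completion_bracket xs xt.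
rewrite (@longest_completed_eq _ _ _ k)// ?kt//.
by rewrite xi -ltnS -(ltr_completion x0) (le_lt_trans it).
Qed.

(** The worst times are those just before a completion: until [completion x i.+1] the longest
    completed contract is still [x i]. *)
Lemma acceleration_ratio_le (R : realType) (x : nat -> R) (r : R) :
  1 <= r -> contract_schedule x ->
  (acceleration_ratio x <= r%:E)%E <-> forall i, completion x i.+1 <= r * x i.
Proof.
move=> r1 xs; have [x0 xi] := xs; split=> [acc i|h].
  have bound t : completion x i <= t < completion x i.+1 -> t <= r * x i.
    move=> it; rewrite -ler_pdivrMr// -lee_fin (le_trans _ acc)//.
    apply: ereal_sup_ubound; exists t => /=; last first.
      by rewrite (@longest_completed_eq _ _ _ i).
    rewrite (le_trans _ (proj1 (andP it)))// -completion0.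
    by rewrite ler_completion.
  rewrite leNgt; apply/negP => rS.
  have iS : completion x i < completion x i.+1 by rewrite ltr_completion.
  (* Either midpoint is a time inside the bracket that exceeds [r * x i], against [bound]. *)
  have [m|m] := leP (r * x i) (completion x i).
    have := bound ((completion x i + completion x i.+1) / 2).
    lra.
  have := bound ((r * x i + completion x i.+1) / 2); lra.
apply: ge_ereal_sup => _ [t /= xt <-]; rewrite lee_fin.
have [i /andP[it ti]] := completion_bracket xs xt.
rewrite (@longest_completed_eq _ _ _ i) ?it// ler_pdivrMr//.
exact: le_trans (ltW ti) (h i).
Qed.

(** * The roots [zeta1], [zeta2] and the function to be minimized *)

Lemma zetaD (R : realType) (r : R) : zeta1 r + zeta2 r = r.
Proof. rewrite /zeta1 /zeta2; lra. Qed.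

Lemma zetaM (R : realType) (r : R) : 4 <= r -> zeta1 r * zeta2 r = r.
Proof.
move=> r4; have : Num.sqrt (r ^+ 2 - 4 * r) ^+ 2 = r ^+ 2 - 4 * r.
  by rewrite sqr_sqrtr//; nra.
rewrite /zeta1 /zeta2; nra.
Qed.

Lemma zeta1_le2 (R : realType) (r : R) : 4 <= r -> zeta1 r <= 2 <= zeta2 r.
Proof.
move=> r4; have := zetaM r4; have := zetaD r.
have : zeta1 r <= zeta2 r.
  rewrite /zeta1 /zeta2; have := sqrtr_ge0 (r ^+ 2 - 4 * r); lra.
move: (zeta1 r) (zeta2 r) => x y xy rD rM; apply/andP; nra.
Qed.

Lemma zeta1_gt1 (R : realType) (r : R) : 4 <= r -> 1 < zeta1 r.
Proof.
move=> r4; have := zetaM r4; have := zetaD r; have /andP[] := zeta1_le2 r4.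
move: (zeta1 r) (zeta2 r) => x y ? ? ? ?; nra.
Qed.

Lemma zeta_itv (R : realType) (r q : R) : 4 <= r -> zeta1 r <= q <= zeta2 r ->
  q ^+ 2 <= r * (q - 1).
Proof.
move=> r4; have := zetaM r4; have := zetaD r.
move: (zeta1 r) (zeta2 r) => x y ? ? /andP[? ?]; nra.
Qed.

Lemma powR_rootK (R : realType) (q : R) p : (0 < p)%N -> 0 <= q ->
  (q `^ p%:R^-1) ^+ p = q.
Proof.
move=> p0 q0; rewrite -powR_mulrn ?powR_ge0// -powRrM mulVf ?powRr1//.
by rewrite pnatr_eq0 -lt0n.
Qed.

Lemma mem_root_itv (R : realType) (u v b : R) p : (0 < p)%N ->
    0 <= u -> 0 <= v -> 0 <= b ->
  (b \in `[u `^ p%:R^-1, v `^ p%:R^-1]) = (u <= b ^+ p <= v).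
Proof.
move=> p0 u0 v0 b0; rewrite in_itv/= -{2}(powR_rootK p0 u0) -{2}(powR_rootK p0 v0).
by rewrite !ler_pXn2r// nnegrE ?powR_ge0.
Qed.

Lemma zeta_root_itv (R : realType) (r b : R) p : 4 <= r -> (0 < p)%N ->
  b \in `[zeta1 r `^ p%:R^-1, zeta2 r `^ p%:R^-1] <->
  1 < b /\ zeta1 r <= b ^+ p <= zeta2 r.
Proof.
move=> r4 p0; have z1 := zeta1_gt1 r4.
have z1ge0 : 0 <= zeta1 r by lra.
have z2ge0 : 0 <= zeta2 r by have /andP[] := zeta1_le2 r4; lra.
split=> [hb|[b1 hb]]; last by rewrite mem_root_itv//; lra.
have b0 : 0 <= b.
  by move: hb; rewrite in_itv/= => /andP[+ _]; apply: le_trans; rewrite powR_ge0.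
move: hb; rewrite mem_root_itv// => /andP[h1 h2]; split; last by rewrite h1.
rewrite ltNge; apply/negP => ble1.
by have := exprn_ile1 p b0 ble1; lra.
Qed.

(** With [q = b ^+ p], the function is [q ^+ 2 / (q - 1)], nonincreasing for [1 < q <= 2], times a
    nonpositive power of [b], because [p + f + 1 <= 2 * p]. As [zeta1 r <= 2], going left of the
    interval cannot lower the value. *)
Lemma ratio_small (R : realType) (p f : nat) (b c : R) : (f < p)%N ->
    1 < b -> b <= c -> c ^+ p <= 2 ->
  c ^+ (p + f + 1) / (c ^+ p - 1) <= b ^+ (p + f + 1) / (b ^+ p - 1).
Proof.
move=> fp b1 bc c2; have p0 : (0 < p)%N by lia.
have c1 : 1 < c by lra.
have q1 : 1 < b ^+ p by rewrite exprn_egt1// -lt0n.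
have s1 : 1 < c ^+ p by rewrite exprn_egt1// -lt0n.
have qs : b ^+ p <= c ^+ p by rewrite ler_pXn2r// nnegrE; lra.
rewrite ler_pdivrMr ?subr_gt0// mulrAC ler_pdivlMr ?subr_gt0//.
have hk : c ^+ (p + f + 1) * (b ^+ p) ^+ 2 <= b ^+ (p + f + 1) * (c ^+ p) ^+ 2.
  have e (x y : R) : x ^+ (p + f + 1) * (y ^+ p) ^+ 2 =
      x ^+ (p + f + 1) * y ^+ (p + f + 1) * y ^+ (p - f - 1).
    by rewrite -mulrA -exprD -exprM; congr (_ * _ ^+ _); lia.
  rewrite !e [b ^+ _ * c ^+ _]mulrC ler_pM2l ?mulr_gt0 ?exprn_gt0//; try lra.
  by case: (p - f - 1)%N => [|k]; rewrite ?expr0// ler_pXn2r// nnegrE; lra.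
have u0 : 0 < c ^+ (p + f + 1) by rewrite exprn_gt0//; lra.
move: (c ^+ (p + f + 1)) (b ^+ (p + f + 1)) (c ^+ p) (b ^+ p) hk u0 q1 s1 qs c2.
move=> u1 u s q hk u0 q1 s1 qs c2.
have h1 : s ^+ 2 * (q - 1) <= q ^+ 2 * (s - 1).
  rewrite -subr_ge0 (_ : _ - _ = (s - q) * (1 - (s - 1) * (q - 1))); last by ring.
  by rewrite mulr_ge0//; nra.
rewrite -(@ler_pM2r _ (s ^+ 2)); last by rewrite exprn_gt0; lra.
have h2 : u1 * (s ^+ 2 * (q - 1)) <= u1 * (q ^+ 2 * (s - 1)) by rewrite ler_pM2l.
have h3 : u1 * q ^+ 2 * (s - 1) <= u * s ^+ 2 * (s - 1) by rewrite ler_pM2r; lra.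
lra.
Qed.

Lemma ratio_min (R : realType) (r : R) (p f : nat) : 4 <= r -> (0 < p)%N ->
  exists2 c, c \in `[zeta1 r `^ p%:R^-1, zeta2 r `^ p%:R^-1] &
    forall b, b \in `[zeta1 r `^ p%:R^-1, zeta2 r `^ p%:R^-1] ->
      c ^+ (p + f + 1) / (c ^+ p - 1) <= b ^+ (p + f + 1) / (b ^+ p - 1).
Proof.
move=> r4 p0; have z1 := zeta1_gt1 r4; have /andP[z12 z22] := zeta1_le2 r4.
apply: (@EVT_min _ (fun b : R => b ^+ (p + f + 1) / (b ^+ p - 1))).
  by apply: ge0_ler_powR; rewrite ?nnegrE ?invr_ge0 ?ler0n//; lra.
apply: continuous_in_subspaceT => b /set_mem/= /(zeta_root_itv _ r4 p0)[b1 /andP[hb _]].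
apply: cvgM; first exact: exprn_continuous.
apply: cvgV; first by rewrite gt_eqF//; lra.
by apply: cvgB; [exact: exprn_continuous|exact: cvg_cst].
Qed.

(** Growth ratios are only eventually below a [Q] beyond [zeta2 r], so the bound [v] has to survive,
    slightly weakened, outside the interval. *)
Lemma ratio_near (R : realType) (r v A : R) (p f : nat) : 4 <= r -> (f < p)%N ->
    (forall b, b \in `[zeta1 r `^ p%:R^-1, zeta2 r `^ p%:R^-1] ->
      v <= b ^+ (p + f + 1) / (b ^+ p - 1)) ->
    0 < A -> A < v ->
  exists Q A', [/\ zeta2 r < Q, A < A' & forall b, 1 < b -> b ^+ p <= Q ->
    A' <= b ^+ (p + f + 1) / (b ^+ p - 1)].
Proof.
move=> r4 fp hv A0 Av; have p0 : (0 < p)%N by lia.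
have z1 := zeta1_gt1 r4; have /andP[z12 z22] := zeta1_le2 r4.
have vge b : 1 < b -> b ^+ p <= zeta2 r -> v <= b ^+ (p + f + 1) / (b ^+ p - 1).
  move=> b1 bz2; have [bz1|bz1] := leP (zeta1 r) (b ^+ p).
    by apply: hv; apply/(zeta_root_itv _ r4 p0); split; rewrite ?bz1.
  have hc : zeta1 r `^ p%:R^-1 \in `[zeta1 r `^ p%:R^-1, zeta2 r `^ p%:R^-1].
    rewrite in_itv/= lexx; apply: ge0_ler_powR; rewrite ?nnegrE ?invr_ge0 ?ler0n//; lra.
  apply: (le_trans (hv _ hc)); apply: ratio_small => //.
    rewrite -(ler_pXn2r p0) ?nnegrE ?powR_ge0//; last by lra.
    by rewrite powR_rootK// ?(ltW bz1)//; lra.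
  by rewrite powR_rootK//; lra.
(* [mu] lies strictly between 1 and [v / A]. Past [zeta2 r] the numerator only grows, while [Q] lets
   the denominator grow by a factor at most [mu]. *)
pose mu := (1 + v / A) / 2.
have mu1 : 1 < mu.
  have : 1 < v / A by rewrite ltr_pdivlMr// mul1r.
  rewrite /mu; lra.
have Amu : A * mu = (A + v) / 2 by rewrite /mu; field; rewrite gt_eqF.
exists (1 + (zeta2 r - 1) * mu), (v / mu); split; first by nra.
  by rewrite ltr_pdivlMr; lra.
move=> b b1 bQ; have q1 : 1 < b ^+ p by rewrite exprn_egt1// -lt0n.
have [bz|zb] := leP (b ^+ p) (zeta2 r).
  apply: le_trans (vge b b1 bz); rewrite ler_pdivrMr; nra.
set c := zeta2 r `^ p%:R^-1.
have cp : c ^+ p = zeta2 r by rewrite powR_rootK//; lra.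
have c0 : 0 <= c by rewrite powR_ge0.
have c1 : 1 < c.
  by rewrite ltNge; apply/negP => c1; have := exprn_ile1 p c0 c1; lra.
have := vge c c1; rewrite cp => /(_ (lexx _)); rewrite ler_pdivlMr; last by lra.
have cb : c <= b by rewrite -(ler_pXn2r p0) ?nnegrE ?cp//; lra.
have : c ^+ (p + f + 1) <= b ^+ (p + f + 1).
  by rewrite ler_pXn2r ?addn1// nnegrE; lra.
move=> h1 h2; rewrite ler_pdivlMr; last by lra.
rewrite mulrAC ler_pdivrMr; last by lra.
have : v * (b ^+ p - 1) <= v * ((zeta2 r - 1) * mu) by rewrite ler_pM2l; lra.
have : v * (zeta2 r - 1) * mu <= b ^+ (p + f + 1) * mu by rewrite ler_pM2r; lra.
lra.
Qed.

(** * Density of covered times on a logarithmic scale *)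

(* Potential of a processor at log-time [tau], when its latest completion is at
   log-time [v] and the one before at [u]. *)
Definition potential (R : realType) (a u v tau : R) : R :=
  Num.min (tau - v + a * u) (a * v).

(** Being useful up to [tau + eta] keeps the first argument of the minimum at least [eta] below
    [a * s n.+1]. Without a new completion that argument gains [eta]; after one, the new potential
    is at least [a * s n.+1]. *)
Lemma potential_step (R : realType) (a : R) (s : nat -> R) n m (tau eta : R) :
    0 <= a -> 0 <= eta -> nondecreasing_seq s ->
    s n.+1 <= tau < s n.+2 -> s m.+1 <= tau + eta < s m.+2 ->
  potential a (s n) (s n.+1) tau <= potential a (s m) (s m.+1) (tau + eta) /\
  (tau + eta <= s n.+1 + a * (s n.+1 - s n) ->
   potential a (s n) (s n.+1) tau + eta <=
   potential a (s m) (s m.+1) (tau + eta)).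
Proof.
move=> a0 eta0 smono /andP[nt tn] /andP[mt tm].
have : (n <= m)%N.
  by rewrite leqNgt; apply/negP => mn; have : s m.+2 <= s n.+1 by [exact: smono]; lra.
rewrite leq_eqVlt => /predU1P[nm|nm].
  subst m; rewrite /potential; split.
    by rewrite le_min !ge_min; apply/andP; split; apply/orP; [left|right]; lra.
  move=> cov; rewrite le_min; apply/andP; split.
    by rewrite addrAC -!lerBrDr ge_min; apply/orP; left; lra.
  by rewrite -lerBrDr ge_min; apply/orP; left; lra.
have /(ler_wpM2l a0) h1 : s n.+1 <= s m by apply: smono.
have /(ler_wpM2l a0) h2 : s m <= s m.+1 by apply: smono.
have lb : a * s n.+1 <= potential a (s m) (s m.+1) (tau + eta).
  by rewrite /potential le_min; apply/andP; split; lra.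
split; first by apply: le_trans lb; rewrite ge_min lexx orbT.
move=> cov; apply: le_trans lb.
by rewrite /potential -lerBrDr ge_min; apply/orP; left; lra.
Qed.

(** Along a grid of step [eta] the total potential gains at least [f.+1%:R * eta] per step, yet it
    stays below [a * p%:R] times the current time, a smaller slope. *)
Lemma no_dense_cover (R : realType) (p f : nat) (s : 'I_p -> nat -> R)
    (a eta tau0 : R) :
    0 <= a -> a * p%:R < f.+1%:R -> 0 < eta ->
    (forall j, nondecreasing_seq (s j)) ->
    (forall j tau, tau0 <= tau -> exists n, s j n.+1 <= tau < s j n.+2) ->
  ~ (forall tau, tau0 <= tau ->
      exists2 B : {set 'I_p}, (f < #|B|)%N & forall j, j \in B ->
        forall n, s j n.+1 <= tau < s j n.+2 ->
          tau + eta <= s j n.+1 + a * (s j n.+1 - s j n)).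
Proof.
move=> a0 apf eta0 smono bracket cover.
pose tau k := tau0 + eta * k%:R.
have tauS k : tau k.+1 = tau k + eta by rewrite /tau -natr1; ring.
have tau0k k : tau0 <= tau k by rewrite lerDl mulr_ge0// ltW.
have [n hn] := choice (fun jk : 'I_p * nat => bracket jk.1 _ (tau0k jk.2)).
pose U k j := potential a (s j (n (j, k))) (s j (n (j, k)).+1) (tau k).
have Ule k : \sum_j U k j <= a * p%:R * tau k.
  rewrite [leRHS](_ : _ = \sum_(j < p) a * tau k); last first.
    by rewrite sumr_const card_ord -[RHS]mulr_natr mulrAC.
  apply: ler_sum => j _; rewrite ge_min ler_wpM2l ?orbT//.
  by have /andP[] := hn (j, k).
have UgeS k : \sum_j U k j + f.+1%:R * eta <= \sum_j U k.+1 j.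
  have [B fB hB] := cover _ (tau0k k).
  rewrite mulr_natl; apply: (@le_trans _ _ (\sum_j (U k j + if j \in B then eta else 0))).
    rewrite big_split lerD2l -big_mkcond sumr_const ler_wpMn2l//.
    exact: ltW.
  apply: ler_sum => j _.
  have hk := hn (j, k); have hk1 := hn (j, k.+1); rewrite /= tauS in hk hk1.
  have [] := potential_step a0 (ltW eta0) (smono j) hk hk1.
  rewrite /U tauS; case: ifP => [jB _|_ + _]; last by rewrite addr0.
  by apply; exact: hB.
have Uge k : \sum_j U 0%N j + f.+1%:R * eta * k%:R <= \sum_j U k j.
  elim: k => [|k ih]; first by rewrite mulr0 addr0.
  by apply: le_trans (UgeS k); rewrite -[k.+1%:R]natr1 mulrDr mulr1 addrA lerD2r.
set C := \sum_j U 0%N j in Uge.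
pose d := (f.+1%:R - a * p%:R) * eta.
have d0 : 0 < d by rewrite mulr_gt0 ?subr_gt0.
have h k : d * k%:R <= a * p%:R * tau0 - C.
  by have := le_trans (Uge k) (Ule k); rewrite /d /tau; lra.
have C0 : 0 <= (a * p%:R * tau0 - C) / d.
  by rewrite divr_ge0 ?(ltW d0)//; have := h 0%N; rewrite mulr0.
have := archi_boundP C0; rewrite ltr_pdivrMr// [_ * d]mulrC ltNge.
by rewrite h.
Qed.

(** * Lower bound for an arbitrary admissible schedule *)

(** The map [t - r * (1 - t^-1)] factors through the two zetas. Hence ratios above [Q] drop by a
    fixed [eta] at each step, and ratios at most [Q] stay there because [r * (1 - t^-1)] increases
    in [t]. *)
Lemma completion_growth (R : realType) (x : nat -> R) (r Q : R) :
    4 <= r -> zeta2 r < Q -> (forall i, 0 < x i) ->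
    (forall i, completion x i.+1 <= r * x i) ->
  exists N, forall n, (N <= n)%N -> completion x n.+1 <= Q * completion x n.
Proof.
move=> r4 zQ x0 hx; have /andP[z12 z22] := zeta1_le2 r4.
have S0 n := completion_gt0 n x0.
pose q n := completion x n.+1 / completion x n.
have q1 n : 1 < q n by rewrite ltr_pdivlMr// mul1r ltr_completion.
have qS n : q n.+1 <= r * (1 - (q n)^-1).
  rewrite ler_pdivrMr// invf_div -mulrA mulrBl mul1r divfK ?gt_eqF//.
  by have := hx n.+1; rewrite (completionS x n) addrAC subrr add0r.
have zeta_root t : 0 < t -> t - r * (1 - t^-1) = (1 - zeta1 r / t) * (t - zeta2 r).
  move=> t0; move: (zeta1 r) (zeta2 r) (zetaM r4) (zetaD r) => y z yz yzr.
  have -> : (1 - y / t) * (t - z) = t - (y + z) + y * z / t by field; rewrite gt_eqF.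
  by rewrite yz yzr; ring.
pose eta := (1 - zeta1 r / Q) * (Q - zeta2 r).
have Q0 : 0 < Q by lra.
have zQ1 : zeta1 r / Q < 1 by rewrite ltr_pdivrMr//; lra.
have eta0 : 0 < eta by rewrite mulr_gt0//; lra.
have qdecr n : Q < q n -> q n.+1 <= q n - eta.
  move=> Qq; apply: le_trans (qS n) _; rewrite lerBrDl -lerBrDr zeta_root; last by lra.
  have z10 := zeta1_gt1 r4.
  have le : zeta1 r / q n <= zeta1 r / Q.
    by rewrite ler_pM2l ?lef_pV2 ?posrE; lra.
  by rewrite ler_pM; lra.
have qstay n : q n <= Q -> q n.+1 <= Q.
  move=> qQ; apply: le_trans (qS n) _; rewrite -subr_ge0.
  have le : Q^-1 <= (q n)^-1 by rewrite lef_pV2// posrE; have := q1 n; lra.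
  have : r * (1 - (q n)^-1) <= r * (1 - Q^-1) by rewrite ler_pM2l; lra.
  have := zeta_root Q Q0; rewrite -/eta; lra.
suff [N qN] : exists N, q N <= Q.
  exists N => n /subnK <-; rewrite -ler_pdivrMr//.
  by elim: (n - N)%N => [//|k ih]; exact: qstay.
apply: contrapT => /forallNP nq.
have {}nq n : Q < q n by rewrite ltNge; apply/negP; exact: nq.
have qn n : q n <= q 0%N - eta * n%:R.
  elim: n => [|n ih]; first by rewrite mulr0 subr0.
  by have := qdecr n (nq n); rewrite -natr1; lra.
have h0 : 0 <= q 0%N / eta by rewrite divr_ge0//; have := q1 0%N; lra.
have := archi_boundP h0; rewrite ltr_pdivrMr//.
by have := qn (Num.bound (q 0%N / eta)); have := q1 (Num.bound (q 0%N / eta)); lra.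
Qed.

(** The contract completed at [v] has length [v - u]. With [b ^+ p = v / u], the hypothesis reads
    [A' * (v - u) <= v * b ^+ f.+1]; the claim is its logarithm after inserting
    [t <= A * (v - u)]. *)
Lemma cover_log (R : realType) (p f : nat) (Q A A' u v t : R) : (0 < p)%N ->
    (forall b, 1 < b -> b ^+ p <= Q -> A' <= b ^+ (p + f + 1) / (b ^+ p - 1)) ->
    0 < A -> 0 < A' -> 0 < u < v -> v <= Q * u -> 0 < t <= A * (v - u) ->
  ln t + ln (A' / A) <= ln v + f.+1%:R / p%:R * (ln v - ln u).
Proof.
move=> p0 hb A0 A'0 /andP[u0 uv] vQ /andP[t0 tA].
have v0 : 0 < v by lra.
pose q := v / u.
have q1 : 1 < q by rewrite ltr_pdivlMr// mul1r.
pose b := q `^ p%:R^-1.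
have bp : b ^+ p = q by rewrite powR_rootK//; lra.
have b0 : 0 <= b by rewrite powR_ge0.
have b1 : 1 < b.
  by rewrite ltNge; apply/negP => b1; have := exprn_ile1 p b0 b1; lra.
have bpos : 0 < b by lra.
have lnb : f.+1%:R / p%:R * (ln v - ln u) = ln (b ^+ f.+1).
  by rewrite lnXn// ln_powR /q ln_div ?posrE// -[RHS]mulr_natl mulrA.
rewrite lnb -!lnM ?posrE ?divr_gt0 ?exprn_gt0// ler_ln ?posrE; last 2 first.
- by rewrite mulr_gt0 ?divr_gt0.
- by rewrite mulr_gt0 ?exprn_gt0.
have := hb b b1; rewrite bp ler_pdivrMr// => /(_ vQ).
rewrite -addnA exprD bp addn1 ler_pdivlMr ?subr_gt0// => h.
have : A' * (v - u) <= v * b ^+ f.+1.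
  have -> : A' * (v - u) = A' * (q - 1) * u by rewrite /q; field; rewrite gt_eqF.
  have -> : v * b ^+ f.+1 = q * b ^+ f.+1 * u.
    by rewrite mulrAC /q divfK ?gt_eqF.
  by rewrite ler_pM2r.
apply: le_trans; rewrite mulrCA ler_pM2l// ler_pdivrMr// mulrC; lra.
Qed.

(** Since [ln v - ln u] is at most [M], lowering the slope by [d / (2 * M)] costs at most half of
    the gain [d]; the other half is [eta]. *)
Lemma cover_log_slack (R : realType) (p f : nat) (Q A A' : R) : (0 < p)%N ->
    (forall b, 1 < b -> b ^+ p <= Q -> A' <= b ^+ (p + f + 1) / (b ^+ p - 1)) ->
    0 < A -> A < A' ->
  exists a eta : R, [/\ 0 <= a, a * p%:R < f.+1%:R, 0 < eta &
    forall u v t, 0 < u < v -> v <= Q * u -> 0 < t <= A * (v - u) ->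
      ln t + eta <= ln v + a * (ln v - ln u)].
Proof.
move=> p0 hb A0 AA'; have A'0 : 0 < A' by lra.
have pp : 0 < p%:R :> R by rewrite ltr0n.
set d := ln (A' / A).
have d0 : 0 < d by rewrite ln_gt0// ltr_pdivlMr// mul1r.
pose c : R := f.+1%:R / p%:R.
have c0 : 0 < c by rewrite divr_gt0.
(* The second argument makes [M] positive and the lowered slope nonnegative. *)
pose M := Num.max (ln Q) (d / (2 * c)).
have M0 : 0 < M by rewrite lt_max divr_gt0 ?orbT// mulr_gt0.
exists (c - d / (2 * M)), (d / 2); split; last 1 first.
- move=> u v t uv vQ tA.
  have := cover_log p0 hb A0 A'0 uv vQ tA; rewrite -/d -/c.
  have /andP[u0 uv'] := uv.
  have v0 : 0 < v by lra.
  have LM : ln v - ln u <= M.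
    rewrite -ln_div ?posrE// le_max ler_ln ?posrE ?divr_gt0//.
      by rewrite ler_pdivrMr// vQ.
    by rewrite -(pmulr_lgt0 _ u0); lra.
  have : d / (2 * M) * (ln v - ln u) <= d / (2 * M) * M.
    by rewrite ler_pM2l// divr_gt0// mulr_gt0.
  have -> : d / (2 * M) * M = d / 2 by field; rewrite gt_eqF.
  lra.
- rewrite subr_ge0 ler_pdivrMr ?mulr_gt0//.
  have c20 : 0 < 2 * c by rewrite mulr_gt0.
  have : d <= M * (2 * c) by rewrite -ler_pdivrMr// le_max lexx orbT.
  by rewrite [M * _]mulrC [2 * c]mulrC -mulrA.
- rewrite mulrBl divfK ?gt_eqF// ltrBlDr ltrDl.
  by rewrite mulr_gt0// divr_gt0// mulr_gt0.
- by rewrite divr_gt0.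
Qed.

Lemma fault_tolerant_acc_ge (R : realType) (r v : R) (p f : nat)
    (Y : 'I_p -> nat -> R) : 4 <= r -> (f < p)%N -> 0 < v ->
    (forall b, b \in `[zeta1 r `^ p%:R^-1, zeta2 r `^ p%:R^-1] ->
      v <= b ^+ (p + f + 1) / (b ^+ p - 1)) ->
    admissible r Y ->
  (v%:E <= fault_tolerant_acc f Y)%E.
Proof.
move=> r4 fp v0 hv admY; rewrite leNgt; apply/negP => accv.
have p0 : (0 < p)%N by lia.
have Ysched j : contract_schedule (Y j) by have [] := admY j.
have Y0 j i : 0 < Y j i by have [+ _] := Ysched j; exact.
have Yr j i : completion (Y j) i.+1 <= r * Y j i.
  have r1 : 1 <= r by lra.
  exact: (proj1 (acceleration_ratio_le r1 (Ysched j)) (proj2 (admY j)) i).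
(* The maximum with [v / 2] makes the bound positive; the value [-oo] is also covered. *)
have [A [A0 Av accA]] : exists A, [/\ 0 < A, A < v & (fault_tolerant_acc f Y <= A%:E)%E].
  move: accv; case: (fault_tolerant_acc f Y) => [a||]; rewrite ?lte_fin ?ltNge ?leey// => av.
    exists (Num.max a (v / 2)); split; rewrite ?lt_max ?gt_max ?lee_fin ?le_max ?lexx//.
      by rewrite divr_gt0 ?orbT.
    by apply/andP; split; lra.
  by exists (v / 2); split; rewrite ?leNye//; lra.
have [Q [A' [zQ AA' hb]]] := ratio_near r4 fp hv A0 Av.
have [a [eta [a0 apf eta0 slack]]] := cover_log_slack p0 hb A0 AA'.
have [N hN] := choice (fun j => completion_growth r4 zQ (Y0 j) (Yr j)).
have S0 j n := completion_gt0 n (Y0 j).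
pose s j n := ln (completion (Y j) n).
have les j n tau : (s j n <= tau) = (completion (Y j) n <= expR tau).
  by rewrite -ler_expR lnK// posrE.
have lts j n tau : (tau < s j n) = (expR tau < completion (Y j) n).
  by rewrite !ltNge les.
(* From [tau0] on, the last completed contract of each processor [j] has index at least [(N j).+1]:
   it has a predecessor, and [hN] applies to the pair. *)
pose tau0 := \big[Num.max/0]_j s j (N j).+1.
have htau0 j tau : tau0 <= tau -> completion (Y j) (N j).+1 <= expR tau.
  by rewrite -les; apply: le_trans; exact: le_bigmax.
have Y0tau j tau : tau0 <= tau -> Y j 0%N <= expR tau.
  by move=> /(htau0 j); apply: le_trans; rewrite -completion0 ler_completion.
apply: (@no_dense_cover _ p f s a eta tau0) => // [j|j tau tau0t|tau tau0t].
- by move=> m n mn; rewrite ler_ln ?posrE// ler_completion.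
- have [i it] := completion_bracket (Ysched j) (Y0tau j _ tau0t).
  have /andP[_ ti] := it.
  have := le_lt_trans (htau0 j _ tau0t) ti; rewrite ltr_completion// ltnS => Ni.
  by case: i Ni it {ti} => // n _ it; exists n; rewrite les lts.
- set t := expR tau.
  have t0 : 0 < t by exact: expR_gt0.
  exists [set j | t / A <= longest_completed (Y j) t]%SET.
    rewrite -longest_completed_faulty_ge//.
    set l := longest_completed_faulty f Y t.
    (* Positivity matters: for [l = 0] the quotient [t / l] would be 0 and bound nothing. By [tau0]
       every processor has completed a contract. *)
    have l0 : 0 < l.
      have /mapP[j _ ->] : l \in [seq longest_completed (Y j) t | j <- enum 'I_p].
        by rewrite -(mem_sort >=%R) mem_nth// size_sort size_map size_enum_ord.
      by apply: lt_le_trans (Y0 j 0%N) _; rewrite le_longest_completed// completion0 Y0tau.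
    rewrite ler_pdivrMr// mulrC -ler_pdivrMr// -lee_fin (le_trans _ accA)//.
    apply: ereal_sup_ubound; exists t => //=.
    by apply: bigmax_le => [|j _]; [exact: ltW|exact: Y0tau].
  move=> j; rewrite inE => tl n; rewrite les lts -/t => nt.
  have Nn : (N j <= n)%N.
    have /andP[_ ti] := nt.
    by have := le_lt_trans (htau0 j _ tau0t) ti; rewrite ltr_completion// !ltnS.
  rewrite -[X in X + eta <= _](expRK tau); apply: slack.
  + by rewrite S0/= ltr_completion//.
  + exact: hN.
  + rewrite t0/= completionS addrAC subrr add0r mulrC -ler_pdivrMr//.
    by rewrite -(longest_completed_eq (Ysched j) nt).
Qed.

(** * Upper bound by the cyclic schedule *)

Definition cyclic_schedule (R : realType) (p : nat) (b : R) (j : 'I_p) (i : nat) : R :=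
  b ^+ (i * p + j).

Lemma completion_cyclic (R : realType) (p : nat) (b : R) (j : 'I_p) i :
  1 < b ->
  completion (cyclic_schedule b j) i = (b ^+ (i * p + p + j) - b ^+ j) / (b ^+ p - 1).
Proof.
move=> b1; have p0 : (0 < p)%N by case: (j); lia.
have q1 : 1 < b ^+ p by rewrite exprn_egt1// -lt0n.
have q0 : b ^+ p - 1 != 0 by rewrite gt_eqF// subr_gt0.
apply: (mulIf q0); rewrite divfK//; elim: i => [|i ih].
  by rewrite completion0 /cyclic_schedule !add0n exprD; ring.
rewrite completionS mulrDl ih /cyclic_schedule.
rewrite (_ : i * p + p + j = i.+1 * p + j)%N; last by lia.
by rewrite (_ : i.+1 * p + p + j = p + (i.+1 * p + j))%N; [rewrite (exprD b p); ring|lia].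
Qed.

Lemma cyclic_schedule_contract (R : realType) (p : nat) (b : R) (j : 'I_p) :
  1 < b -> contract_schedule (cyclic_schedule b j).
Proof.
move=> b1; split=> [i|m n]; first by rewrite exprn_gt0//; lra.
have p0 : (0 < p)%N by case: (j); lia.
by rewrite /cyclic_schedule ler_eXn2l// leq_add2r leq_pmul2r.
Qed.

(** Dropping the subtracted [b ^+ j], completion [i.+1] is at most contract [i] times
    [q ^+ 2 / (q - 1)] with [q = b ^+ p], and [zeta_itv] bounds this factor by [r]. *)
Lemma cyclic_schedule_admissible (R : realType) (p : nat) (r b : R) :
    4 <= r -> 1 < b -> zeta1 r <= b ^+ p <= zeta2 r ->
  admissible r (@cyclic_schedule R p b).
Proof.
move=> r4 b1 hb j; have cs := cyclic_schedule_contract j b1; split=> //.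
have p0 : (0 < p)%N by case: (j); lia.
have q1 : 1 < b ^+ p by rewrite exprn_egt1// -lt0n.
apply/acceleration_ratio_le => //; first by lra.
move=> i; rewrite completion_cyclic// ler_pdivrMr ?subr_gt0//.
have bj : 0 < b ^+ j by rewrite exprn_gt0//; lra.
have x0 : 0 < cyclic_schedule b j i by have [+ _] := cs; exact.
have : cyclic_schedule b j i * (b ^+ p) ^+ 2 <= cyclic_schedule b j i * (r * (b ^+ p - 1)).
  by rewrite ler_pM2l//; exact: zeta_itv.
rewrite {1}/cyclic_schedule -exprM -exprD (_ : i * p + j + p * 2 = i.+1 * p + p + j)%N; last by lia.
lra.
Qed.

(* [n] numbers the contracts of the cyclic schedule in the order in which they
   complete; contract [n] has length [b ^+ n] and runs on processor [n %% p]. *)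
Lemma fault_tolerant_acc_cyclic (R : realType) (p f : nat) (b : R) :
    (f < p)%N -> 1 < b ->
  (fault_tolerant_acc f (@cyclic_schedule R p b) <=
   (b ^+ (p + f + 1) / (b ^+ p - 1))%:E)%E.
Proof.
move=> fp b1; have p0 : (0 < p)%N by lia.
have b0 : 0 < b by lra.
have q1 : 1 < b ^+ p by rewrite exprn_egt1// -lt0n.
have q0 : 0 < b ^+ p - 1 by rewrite subr_gt0.
pose C n := (b ^+ (n + p) - b ^+ (n %% p)) / (b ^+ p - 1).
pose proc n := Ordinal (ltn_pmod n p0).
have procE n : cyclic_schedule b (proc n) (n %/ p) = b ^+ n.
  by rewrite /cyclic_schedule /= -divn_eq.
have CE n : completion (cyclic_schedule b (proc n)) (n %/ p) = C n.
  by rewrite completion_cyclic// /C /= addnAC -divn_eq.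
have C_S n : C n <= C n.+1.
  rewrite ler_pM2r ?invr_gt0// addSn exprS.
  have bn : 1 <= b ^+ (n %% p) by rewrite exprn_ege1// ltW.
  have bnp : b ^+ (n %% p) <= b ^+ (n + p).
    by rewrite ler_eXn2l// (leq_trans (leq_mod _ _))// leq_addr.
  have h : b ^+ (n.+1 %% p) <= b * b ^+ (n %% p).
    rewrite -exprS ler_eXn2l// -addn1 -modnDml addn1.
    exact: leq_mod.
  nra.
have C_mono : {homo C : m n / (m <= n)%N >-> m <= n}.
  by apply: homo_leq => [//|? ? ?|]; [exact: le_trans|exact: C_S].
apply: ge_ereal_sup => _ [t /= tmax <-]; rewrite lee_fin.
(* Contract [p.-1] is the first one on the last processor, so [t] is past the first round. *)
have Cp1 : C p.-1 <= t.
  apply: le_trans tmax; rewrite -CE divn_small ?prednK// completion0.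
  exact: (le_bigmax _ (fun j => cyclic_schedule b j 0%N)).
have ex : exists n, t < C n.
  have [i /andP[_ ti]] := completion_bracket
    (cyclic_schedule_contract (proc 0) b1)
    (le_trans (le_bigmax 0 (fun j => cyclic_schedule b j 0%N) (proc 0)) tmax).
  exists (i.+1 * p)%N; move: ti; rewrite -CE mulnK//.
  by rewrite (_ : proc (i.+1 * p) = proc 0)//; apply: val_inj; rewrite /= modnMl mod0n.
case: (ex_minnP ex) => -[|n] tn nmin.
  by move: tn; rewrite ltNge (le_trans _ Cp1)// C_mono.
have nt : C n <= t by rewrite leNgt; apply/negP => /nmin; rewrite ltnn.
(* Hence [f <= n], and the subtraction [n - f] below is not truncated. *)
have pn : (p <= n.+1)%N.
  rewrite leqNgt; apply/negP => np; move: tn; rewrite ltNge (le_trans _ Cp1)//.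
  by apply: C_mono; lia.
have l_ge : b ^+ (n - f) <= longest_completed_faulty f (@cyclic_schedule R p b) t.
  rewrite longest_completed_faulty_ge//.
  (* The last [f.+1] completed contracts are on distinct processors, as [f < p], and the shortest of
     them has length [b ^+ (n - f)]. *)
  pose g (k : 'I_f.+1) := proc (n - k)%N.
  have g_inj : injective g.
    have mod_inj k1 k2 : (k1 <= k2 <= f)%N -> ((n - k1) %% p = (n - k2) %% p)%N ->
        k1 = k2.
      move=> /andP[k12 k2f] /eqP; rewrite eqn_mod_dvd; last by lia.
      move=> /dvdnP[[|d] hd]; first by lia.
      by have : (p <= d.+1 * p)%N by [rewrite leq_pmull]; lia.
    move=> [k1 h1] [k2 h2] /(congr1 val)/= h; apply: val_inj => /=.
    by have [k12|/ltnW k21] := leqP k1 k2; [|symmetry]; apply: mod_inj; rewrite ?k12 ?k21.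
  have <- : #|[set g k | k in 'I_f.+1]%SET| = f.+1 by rewrite card_imset// card_ord.
  apply: subset_leq_card; apply/fintype.subsetP => j /imsetP[k _ ->]; rewrite inE.
  have kf := ltn_ord k.
  apply: (@le_trans _ _ (b ^+ (n - k))); first by rewrite ler_eXn2l//; lia.
  rewrite -procE; apply: le_longest_completed; first exact: cyclic_schedule_contract.
  by rewrite CE (le_trans _ nt)// C_mono// leq_subr.
have l0 : 0 < b ^+ (n - f) by rewrite exprn_gt0.
rewrite ler_pdivrMr; last exact: lt_le_trans l_ge.
have v0 : 0 < b ^+ (p + f + 1) / (b ^+ p - 1) by rewrite divr_gt0 ?exprn_gt0.
apply: (@le_trans _ _ (b ^+ (p + f + 1) / (b ^+ p - 1) * b ^+ (n - f))); last by rewrite ler_pM2l.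
(* [t] is below [C n.+1], whose numerator without the subtracted term is exactly
   [b ^+ (p + f + 1) * b ^+ (n - f)]. *)
apply: le_trans (ltW tn) _; rewrite mulrAC ler_pM2r ?invr_gt0// -exprD.
rewrite (_ : p + f + 1 + (n - f) = n.+1 + p)%N; last by lia.
by rewrite gerBl exprn_ge0// ltW.
Qed.

Theorem theorem10 (R : realType) (r : R) (p f : nat)
    (hr : 4 <= r) (hfp : (f < p)%N) :
  exists (X : 'I_p -> nat -> R) (v : R),
    [/\ admissible r X,
        forall Y : 'I_p -> nat -> R, admissible r Y ->
          (fault_tolerant_acc f X <= fault_tolerant_acc f Y)%E,
        is_minimum [set b ^+ (p + f + 1) / (b ^+ p - 1) |
                    b in `[zeta1 r `^ (p%:R^-1), zeta2 r `^ (p%:R^-1)]] v &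
        fault_tolerant_acc f X = v%:E].
Proof.
have p0 : (0 < p)%N by exact: leq_ltn_trans hfp.
have [c hc cmin] := ratio_min f hr p0.
have /(zeta_root_itv _ hr p0)[c1 cz] := hc.
set v := c ^+ (p + f + 1) / (c ^+ p - 1) in cmin.
have v0 : 0 < v.
  rewrite divr_gt0 ?exprn_gt0 ?subr_gt0 ?exprn_egt1 -?lt0n//.
  exact: lt_trans c1.
have admX := cyclic_schedule_admissible hr c1 cz.
have accX : fault_tolerant_acc f (@cyclic_schedule R p c) = v%:E.
  apply/eqP; rewrite eq_le fault_tolerant_acc_cyclic//=.
  (* The general lower bound applies to the cyclic schedule itself, which makes its value exact. *)
  exact: fault_tolerant_acc_ge cmin admX.
exists (@cyclic_schedule R p c), v; split=> //.
- by move=> Y admY; rewrite accX; exact: fault_tolerant_acc_ge cmin admY.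
- by split=> [|_ [b hb <-]]; [exists c|exact: cmin].
Qed.
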